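(* Let $(X,\mathcal{A})$ be a measurable space. The following statements are equivalent. (1) $(X,\mathcal{A})$ is compact. (2) Every proper ideal in $M(X)$ is fixed. (3) Every maximal ideal in $M(X)$ is fixed. (4) Every $Z_{\mathcal{A}}$-filter in $\mathcal{A}$ is fixed. (5) Every $Z_{\mathcal{A}}$-ultrafilter in $\mathcal{A}$ is fixed.
   Context: A measurable space $(X,\mathcal{A})$ is a nonempty set $X$ with a $\sigma$-algebra $\mathcal{A}$ of subsets of $X$. $M(X)$ is the commutative ring (pointwise operations) of all functions $f:X\to\mathbb{R}$ with $f^{-1}(V)\in\mathcal{A}$ for every open $V\subseteq\mathbb{R}$. For $f\in M(X)$, $Z(f)=\{x\in X: f(x)=0\}$. $(X,\mathcal{A})$ is a compact measurable space if $\mathcal{A}$, ordered by inclusion, is a compact lattice, i.e. its top element $X$ is compact: whenever $X=\bigvee S$ with $S\subseteq\mathcal{A}$, there is a finite $T\subseteq S$ with $X=\bigvee T$. An ideal $I$ of $M(X)$ is fixed if $\bigcap_{f\in I}Z(f)\neq\emptyset$. A subset $\mathcal{K}\subseteq\mathcal{A}$ is fixed if $\bigcap\mathcal{K}\neq\emptyset$. A $Z_{\mathcal{A}}$-filter on $X$ is a proper filter of the lattice $\mathcal{A}$ (a nonempty proper subset of $\mathcal{A}$ closed under finite intersections and under passing to larger members of $\mathcal{A}$). A $Z_{\mathcal{A}}$-ultrafilter is a $Z_{\mathcal{A}}$-filter that is maximal under inclusion among all $Z_{\mathcal{A}}$-filters on $X$. *)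

(* Defs.v *)
From HB Require Import structures.
From mathcomp Require Import all_boot all_order all_algebra.
From mathcomp Require Import all_classical all_reals all_analysis.
From mathcomp Require Import measurable_realfun.
Set Implicit Arguments.
Unset Strict Implicit.
Unset Printing Implicit Defensive.
Import Order.TTheory GRing.Theory Num.Theory.
Import numFieldNormedType.Exports.
Local Open Scope classical_set_scope.
Local Open Scope ring_scope.

(* A measurable space is a [measurableType]; the library's hierarchy makes it
   pointed, hence nonempty. *)

Section measurable_lattice.
Context (d : measure_display) (T : measurableType d).

Definition measurable_pred : {pred set T} := [in @measurable d T].

(* The sigma-algebra as a type, with the order induced by the library's
   inclusion order on [set T]. *)
Definition measurable_lattice := {A : set T | A \in measurable_pred}.

Lemma measurable_predI : {in measurable_pred &, forall A B,
  Order.meet A B \in measurable_pred}.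
Proof. by move=> A B /set_mem mA /set_mem mB; apply/mem_set/measurableI. Qed.

Lemma measurable_predU : {in measurable_pred &, forall A B,
  Order.join A B \in measurable_pred}.
Proof. by move=> A B /set_mem mA /set_mem mB; apply/mem_set/measurableU. Qed.

Lemma measurable_pred0 : (\bot : set T)%O \in measurable_pred.
Proof. exact/mem_set/measurable0. Qed.

Lemma measurable_predT : (\top : set T)%O \in measurable_pred.
Proof. exact/mem_set/measurableT. Qed.

HB.instance Definition _ := @Order.isTBLatticeClosed.Build set_display (set T)
  measurable_pred measurable_predI measurable_predU
  measurable_pred0 measurable_predT.

HB.instance Definition _ := SubChoice.on measurable_lattice.
HB.instance Definition _ :=
  [SubChoice_isTBSubLattice of measurable_lattice by <: with set_display].

Lemma measurable_latticeP (A : measurable_lattice) : measurable (\val A).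
Proof. exact/set_mem/(valP A). Qed.

Lemma measurable_lattice_leE (A B : measurable_lattice) :
  (A <= B)%O = (\val A `<=` \val B) :> Prop.
Proof. by rewrite -subsetEset -Order.le_val. Qed.

Lemma measurable_lattice_meetE (A B : measurable_lattice) :
  \val (A `&` B)%O = \val A `&` \val B.
Proof. by []. Qed.

Lemma measurable_lattice_topE : \val (\top : measurable_lattice)%O = [set: T].
Proof. by []. Qed.

End measurable_lattice.

Definition maximal_among {U : Type} (P : set (set U)) (A : set U) : Prop :=
  P A /\ forall B, P B -> A `<=` B -> B = A.

Section lattices.
Context (d : Order.disp_t).

(* Compactness of the top element: [isLub S m] is m = \/ S.  The lattice need
   not be complete, and \/ S is the join computed in L (for a sigma-algebra it
   may strictly contain the union of S). *)
Definition compact_lattice (L : tbLatticeType d) : Prop :=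
  forall S : set L, isLub S \top%O ->
    exists F : set L, [/\ finite_set F, F `<=` S & isLub F \top%O].

Definition proper_lattice_filter (L : latticeType d) (F : set L) : Prop :=
  [/\ F !=set0, F <> [set: L],
      forall a b, F a -> F b -> F (a `&` b)%O &
      forall a b, F a -> (a <= b)%O -> F b].

Definition lattice_ultrafilter (L : latticeType d) : set (set L) :=
  maximal_among (@proper_lattice_filter L).

End lattices.

Section rings.
Context (A : comNzRingType).

(* The library's [idealr_closed] includes properness, [1 \notin I]. *)
Definition is_proper_ideal (I : set A) : Prop := idealr_closed [in I].

Definition is_maximal_ideal : set (set A) := maximal_among is_proper_ideal.

End rings.

Section measurable_spaces.
Context (R : realType) (d : measure_display) (T : measurableType d).

(* M(X) is the ring {mfun T >-> R} of functions measurable with respect to the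
   Borel sigma-algebra of R, equivalently with respect to open sets: *)
Lemma measurable_fun_openP (f : T -> R) :
  measurable_fun [set: T] f <->
  forall V : set R, open V -> measurable (f @^-1` V).
Proof.
split=> [mf V oV|mf].
  by rewrite -[_ @^-1` _]setTI; apply: mf => //; exact: open_measurable.
apply: (measurability _ (RGenOpens.measurableE R)) => _ [_ [x [y ->]] <-].
by rewrite setTI; apply: mf; exact: interval_open.
Qed.

Definition zero_set (f : {mfun T >-> R}) : set T := [set x | f x = 0].

Definition fixed_ideal (I : set {mfun T >-> R}) : Prop :=
  \bigcap_(f in I) zero_set f !=set0.

Definition compact_measurable_space : Prop :=
  compact_lattice (measurable_lattice T).

Definition fixed_family (K : set (measurable_lattice T)) : Prop :=
  \bigcap_(A in K) (\val A : set T) !=set0.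

End measurable_spaces.

(* Main.v *)
Require Import Defs.
From HB Require Import structures.
From mathcomp Require Import all_boot all_order all_algebra.
From mathcomp Require Import all_classical all_reals all_analysis.
From mathcomp Require Import measurable_realfun.
Set Implicit Arguments.
Unset Strict Implicit.
Unset Printing Implicit Defensive.
Import Order.TTheory GRing.Theory Num.Theory.
Import numFieldNormedType.Exports.
Local Open Scope classical_set_scope.
Local Open Scope ring_scope.

(** The five conditions are linked through one of them: every proper filter of
the sigma-algebra has a common point.  It is equivalent to its restriction to
ultrafilters, and it is implied by the condition on maximal ideals, by Zorn's
lemma: a filter extends to an ultrafilter, and the functions whose zero set
lies in a filter form a proper ideal, which extends to a maximal one; a point
where that maximal ideal vanishes belongs to every A of the filter, because
the indicator of the complement of A is in the ideal.  Conversely the zero sets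
of a proper ideal are nonempty (a nowhere vanishing function is invertible)
and directed downwards (the zeros of f^2 + g^2 are the common zeros of f and
g), so they generate a proper filter, and a common point of that filter fixes
the ideal.

If the lattice is compact, so that top is reached by finitely many elements of
any S with join top, then a filter without common point would give such an S:
the complements of its members.  Finitely many of these would already have
join top, hence finitely many members of the filter would have meet bottom
([compact_fixed_family]).

The remaining implication, from fixed filters to compactness
([filter_fixed_compact]), has one difficulty: a family S may have join top
without covering the space, since joins are taken in the sigma-algebra.  If no
finite part of S has join top, the complements of finite unions from S have a
common point x, which no member of S contains.  This is not yet a
contradiction.  It becomes one if x has a least measurable neighbourhood C
([least_measurable_neighbourhood]): every member of S avoids x, hence avoids C,
so the complement of C is an upper bound of S that is not top.  Such a C exists
because no sequence B of measurable sets is strictly decreasing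
([measurable_not_strictly_decreasing]): otherwise the nonempty sets
B n minus the intersection of B would generate a filter without common point.
This is where closure under countable intersections is used. *)

(** * Zorn's lemma above a given set *)

(** Zorn's lemma for inclusion gives a maximal set, but not one that contains
A0, and it also asks about the empty chain.  Applied to the sets B such that
A0 union B satisfies P, it answers both: the empty chain yields A0. *)
Lemma maximal_among_extension {U : Type} (P : set (set U)) (A0 : set U) :
  (forall C : set (set U), C !=set0 -> C `<=` P -> total_on C subset ->
    P (\bigcup_(X in C) X)) ->
  P A0 -> exists2 M, maximal_among P M & A0 `<=` M.
Proof.
move=> Pchain PA0.
have [|A [PA maxA]] := @Zorn_bigcup U (fun B => P (A0 `|` B)).
  move=> C CP Ctot; have [->|/set0P C0] := eqVneq C set0.
    by rewrite bigcup_set0 setU0.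
  have -> : A0 `|` \bigcup_(X in C) X =
            \bigcup_(Y in [set A0 `|` X | X in C]) Y.
    apply/seteqP; split=> [x [A0x|[X CX Xx]]|x [_ [X CX <-]] [A0x|Xx]].
    - by case: C0 => X CX; exists (A0 `|` X); [exists X|left].
    - by exists (A0 `|` X); [exists X|right].
    - by left.
    - by right; exists X.
  apply: Pchain.
  - by case: C0 => X CX; exists (A0 `|` X); exists X.
  - by move=> _ [X CX <-]; exact: CP.
  - move=> _ _ [X CX <-] [Y CY <-].
    by have [XY|YX] := Ctot _ _ CX CY; [left|right]; exact: setUS.
exists (A0 `|` A); last exact: subsetUl.
split=> // B PB AB; apply: contrapT => BA; apply: (maxA B).
  split; first by apply: subset_trans AB; exact: subsetUr.
  move=> BsubA; apply: BA; apply/seteqP; split=> //.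
  exact: subset_trans (@subsetUr _ _ _).
suff -> : A0 `|` B = B by [].
by apply/setUidPr; apply: subset_trans AB; exact: subsetUl.
Qed.

Lemma chain_sub2 {U : Type} (C : set (set U)) (X Y : set U) :
  total_on C subset -> C X -> C Y ->
  exists2 Z, C Z & X `<=` Z /\ Y `<=` Z.
Proof.
by move=> Ctot CX CY; have [XY|YX] := Ctot _ _ CX CY; [exists Y|exists X];
  do ?split.
Qed.

(** * Filters and ideals *)

Section lattice_filters.
Context (d : Order.disp_t) (L : tbLatticeType d).
Implicit Types (K : set L).

Lemma proper_filter_top K : proper_lattice_filter K -> K \top%O.
Proof. by move=> [[a Ka] _ _ Kup]; apply: Kup Ka _; exact: lex1. Qed.

Lemma proper_filter_bot K : proper_lattice_filter K -> ~ K \bot%O.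
Proof.
move=> [_ KT _ Kup] K0; apply: KT; apply/seteqP; split=> // a _.
by apply: Kup K0 _; exact: le0x.
Qed.

Lemma proper_filter_lower_bound K (D : set L) : proper_lattice_filter K ->
  finite_set D -> D `<=` K -> exists2 b, K b & forall a, D a -> (b <= a)%O.
Proof.
move=> Kf /finite_seqP[s ->]; elim: s => [|a s IHs] DK.
  by exists \top%O; [exact: proper_filter_top|].
have [|b Kb bs] := IHs.
  by move=> c cs; apply: DK; rewrite /= inE cs orbT.
exists (a `&` b)%O.
  case: (Kf) => _ _ KI _; apply: KI => //; apply: DK.
  by rewrite /= inE eqxx.
move=> c; rewrite /= inE => /orP[/eqP ->|/bs bc]; first exact: leIl.
by apply: le_trans bc; exact: leIr.
Qed.

Lemma proper_filter_sub_ultrafilter K : proper_lattice_filter K ->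
  exists2 M, lattice_ultrafilter M & K `<=` M.
Proof.
apply: maximal_among_extension => C [X0 CX0] CP Ctot; split.
- by case: (CP _ CX0) => -[a X0a] _ _ _; exists a, X0.
- move=> CT; have [X CX X0bot] : (\bigcup_(X in C) X) \bot%O by rewrite CT.
  exact: proper_filter_bot (CP _ CX) _.
- move=> a b [X CX Xa] [Y CY Yb].
  have [Z CZ [XZ YZ]] := chain_sub2 Ctot CX CY.
  exists Z => //; case: (CP _ CZ) => _ _ ZI _.
  by apply: ZI; [exact: XZ|exact: YZ].
- move=> a b [X CX Xa] ab; exists X => //.
  by case: (CP _ CX) => _ _ _; apply; eauto.
Qed.

End lattice_filters.

Section ideals.
Context (A : comNzRingType).

Lemma is_proper_idealP (I : set A) : is_proper_ideal I <->
  [/\ I 0, ~ I 1 & forall a u v, I u -> I v -> I (a * u + v)].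
Proof.
rewrite /is_proper_ideal /idealr_closed; split=> -[I0 I1 Ilin]; split.
- by move: I0; rewrite inE.
- by move=> /mem_set; exact/negP.
- by move=> a u v /mem_set Iu /mem_set Iv; apply/set_mem; exact: Ilin.
- exact/mem_set.
- by apply/negP => /set_mem.
- by move=> a u v /set_mem Iu /set_mem Iv; apply/mem_set; exact: Ilin.
Qed.

Lemma proper_ideal_sub_maximal (I : set A) : is_proper_ideal I ->
  exists2 M, is_maximal_ideal M & I `<=` M.
Proof.
apply: maximal_among_extension => C [X0 CX0] CP Ctot; apply/is_proper_idealP.
split.
- by have /is_proper_idealP[? _ _] := CP _ CX0; exists X0.
- by move=> [X CX X1]; have /is_proper_idealP[] := CP _ CX.
- move=> a u v [X CX Xu] [Y CY Yv].
  have [Z CZ [XZ YZ]] := chain_sub2 Ctot CX CY; exists Z => //.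
  have /is_proper_idealP[_ _ Zlin] := CP _ CZ.
  by apply: Zlin; [exact: XZ|exact: YZ].
Qed.

End ideals.

(** * Fixed filters and compactness *)

Section measurable_elements.
Context (d : measure_display) (T : measurableType d).

Definition measurable_element (A : set T) (mA : measurable A) :
    measurable_lattice T :=
  exist _ A (mem_set mA).

Definition measurable_compl (A : measurable_lattice T) : measurable_lattice T :=
  measurable_element (measurableC (measurable_latticeP A)).

Lemma measurable_lattice_inj (A B : measurable_lattice T) :
  (\val A : set T) = \val B -> A = B.
Proof. exact: val_inj. Qed.

Lemma measurable_complK : involutive measurable_compl.
Proof. by move=> A; apply: measurable_lattice_inj; rewrite /= setCK. Qed.

Lemma measurable_lattice_botE : \val (\bot : measurable_lattice T)%O = set0.
Proof. by []. Qed.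

Definition all_filters_fixed : Prop := forall K : set (measurable_lattice T),
  proper_lattice_filter K -> fixed_family K.

(** When K has no common point, the complements of its members cover T and
their join is top; a finite part with join top yields, by complementation, a
member of K below bottom. *)
Lemma compact_fixed_family : compact_measurable_space T -> all_filters_fixed.
Proof.
move=> cT K Kf; apply: contrapT => Knfix.
have [|F [Ffin FK [_ Flub]]] := cT [set A | K (measurable_compl A)].
  split=> [A _|B Bub]; first exact: lex1.
  rewrite measurable_lattice_leE => x _; apply: contrapT => Bx.
  apply: Knfix; exists x => A KA; apply: contrapT => Ax.
  apply: Bx; have := Bub (measurable_compl A).
  rewrite measurable_lattice_leE; apply=> //.
  by rewrite /= measurable_complK.
have [|||b Kb bF] :=
  @proper_filter_lower_bound _ _ K (measurable_compl @` F) => //.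
- exact: finite_image.
- by move=> _ [A FA <-]; exact: FK.
apply: (proper_filter_bot Kf); suff -> : \bot%O = b by [].
apply/esym/measurable_lattice_inj.
rewrite measurable_lattice_botE -subset0 => x bx.
have := Flub (measurable_compl b); rewrite measurable_lattice_leE.
suff /[swap]/[apply] : ubound F (measurable_compl b) by move=> /(_ x I).
move=> A FA; rewrite measurable_lattice_leE => y Ay yb.
have := bF (measurable_compl A).
by rewrite measurable_lattice_leE => /(_ _ y yb); apply.
Qed.

(** The family generates a proper filter.  Indexing it by an arbitrary type lets
the same lemma serve sequences of sets, finite subfamilies of a cover, and the
functions of an ideal. *)
Lemma directed_family_fixed (U : Type) (D : set U) (f : U -> set T) :
  all_filters_fixed ->
  D !=set0 -> (forall i, D i -> measurable (f i)) ->
  (forall i, D i -> f i !=set0) ->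
  (forall i j, D i -> D j -> exists2 k, D k & f k `<=` f i `&` f j) ->
  \bigcap_(i in D) f i !=set0.
Proof.
move=> filter_fixed [i0 Di0] mf f0 fdir.
pose K := [set A : measurable_lattice T | exists2 i, D i & f i `<=` \val A].
have [|x Kx] := filter_fixed K.
  split.
  - by exists \top%O, i0.
  - move=> KT; have [i Di] : K \bot%O by rewrite KT.
    by have [x fx] := f0 _ Di; move=> /(_ x fx).
  - move=> A B [i Di iA] [j Dj jB]; have [k Dk kij] := fdir _ _ Di Dj.
    by exists k => // x /kij[fix_ fjx]; split; [exact: iA|exact: jB].
  - move=> A B [i Di iA]; rewrite measurable_lattice_leE => AB.
    by exists i => //; exact: subset_trans AB.
exists x => i Di; apply: (Kx (measurable_element (mf i Di))).
by exists i.
Qed.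

(** If every step of B were strict, then each B n minus the intersection of all
of them would be nonempty, and these differences decrease to the empty set. *)
Lemma measurable_not_strictly_decreasing (B : nat -> set T) :
  all_filters_fixed ->
  (forall n, measurable (B n)) -> (forall n, B n.+1 `<=` B n) ->
  exists n, B n `<=` B n.+1.
Proof.
move=> filter_fixed mB decB; apply: contrapT => nsub.
have monoB n m : (n <= m)%N -> B m `<=` B n.
  elim: m => [|m IHm]; first by rewrite leqn0 => /eqP ->.
  rewrite leq_eqVlt => /orP[/eqP ->//|/IHm]; exact: subset_trans.
have [||||x xB] := @directed_family_fixed nat setT
  (fun n => B n `\` \bigcap_m B m) filter_fixed.
- by exists 0%N.
- move=> n _; apply: measurableD => //; exact: bigcapT_measurable.
- move=> n _; apply: contrapT => Bn; apply: nsub; exists n => x Bnx.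
  by apply: contrapT => BSnx; apply: Bn; exists x; split=> // /(_ n.+1 I).
- move=> n m _ _; exists (maxn n m) => // x [Bx nBx].
  by split; split=> //; apply: monoB Bx; [exact: leq_maxl|exact: leq_maxr].
by have [_] := xB 0%N I; apply=> n _; have [] := xB n I.
Qed.

(** Otherwise every measurable set around x could be shrunk strictly, and
iterating this from the whole space would give a strictly decreasing
sequence. *)
Lemma least_measurable_neighbourhood (x : T) : all_filters_fixed ->
  exists C : set T,
    [/\ measurable C, C x & forall B, measurable B -> B x -> C `<=` B].
Proof.
move=> filter_fixed; apply: contrapT => noC.
(* [choice] needs a total relation on all sets, whence the hypotheses on C
   inside the relation. *)
have /choice[g gP] : forall C : set T, exists C' : set T,
    measurable C -> C x -> [/\ measurable C', C' x & C' `<=` C /\ ~ C `<=` C'].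
  move=> C; have [[mC Cx]|nC] := pselect (measurable C /\ C x); last first.
    by exists C => mC Cx; case: nC.
  apply: contrapT => nC'; apply: noC; exists C; split=> // B mB Bx y Cy.
  apply: contrapT => nBy; apply: nC'; exists (C `&` B) => _ _; split=> //.
    exact: measurableI.
  by split=> [z []//|/(_ y Cy)[]].
pose B n := iter n g setT.
have BP n : measurable (B n) /\ B n x.
  elim: n => [|n [mB Bx]]; first by split=> //; exact: measurableT.
  by have [? ? _] := gP _ mB Bx; split.
have [||n] := @measurable_not_strictly_decreasing B filter_fixed.
- by move=> n; case: (BP n).
- by move=> n; have [mB Bx] := BP n; have [_ _ []] := gP _ mB Bx.
- by have [mB Bx] := BP n; have [_ _ []] := gP _ mB Bx.
Qed.

(** A family S with join top need not cover T, so the point x missed by S is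
not in itself absurd; its least measurable neighbourhood is disjoint from every
member of S, and this is what contradicts the join being top. *)
Lemma filter_fixed_compact : all_filters_fixed -> compact_measurable_space T.
Proof.
move=> filter_fixed S [_ Slub]; apply: contrapT => nfin.
have [||||x xS] := @directed_family_fixed (set (measurable_lattice T))
  [set F | finite_set F /\ F `<=` S] (fun F => ~` \bigcup_(A in F) \val A)
  filter_fixed.
- by exists set0; split; [exact: finite_set0|exact: sub0set].
- move=> F [Ffin _]; apply: measurableC; apply: fin_bigcup_measurable => // A _.
  exact: measurable_latticeP.
- move=> F [Ffin FS]; apply: contrapT => F0; apply: nfin; exists F; split=> //.
  split=> [A _|B Bub]; first exact: lex1.
  rewrite measurable_lattice_leE => x _; apply: contrapT => Bx; apply: F0.
  exists x => -[A FA Ax]; apply: Bx.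
  by have := Bub _ FA; rewrite measurable_lattice_leE; apply.
- move=> F G [Ffin FS] [Gfin GS]; exists (F `|` G).
    by split; [rewrite finite_setU|rewrite subUset].
  by rewrite bigcup_setU setCU.
have Sx A : S A -> ~ (\val A : set T) x.
  move=> SA Ax; apply: (xS [set A]); last by exists A.
  by split; [exact: finite_set1|move=> _ ->].
have [C [mC Cx Cmin]] := least_measurable_neighbourhood x filter_fixed.
pose nC := measurable_compl (measurable_element mC).
have := Slub nC; rewrite measurable_lattice_leE.
suff /[swap]/[apply] : ubound S nC by move=> /(_ x I); apply.
move=> A SA; rewrite measurable_lattice_leE => y Ay /= Cy.
apply: (Cmin (~` \val A) _ (Sx A SA) y Cy) => //.
exact/measurableC/measurable_latticeP.
Qed.

End measurable_elements.

(** * Zero sets of measurable functions *)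

Section zero_sets.
Context (R : realType) (d : measure_display) (T : measurableType d).
Implicit Types (f g : {mfun T >-> R}).

Lemma measurable_zero_set f : measurable (zero_set f).
Proof. exact: (measurable_funPTI f (measurable_set1 0)). Qed.

Lemma zero_set_sum_squares f g :
  zero_set (f * f + g * g) = zero_set f `&` zero_set g.
Proof.
apply/seteqP; split=> [x|x []]; rewrite /zero_set /=; last first.
  by move=> fx gx; rewrite !fctE fx gx !mul0r addr0.
rewrite !fctE -!expr2 => /eqP.
by rewrite paddr_eq0 ?sqr_ge0 // !expf_eq0 /= => /andP[/eqP -> /eqP ->].
Qed.

(** The inverse of f is f / f^2; the power function x `^ (-1) is known to be
measurable on the whole line and agrees with the inverse on positive reals such
as f^2. *)
Lemma zero_set0_unit f : zero_set f = set0 -> exists g, g * f = 1.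
Proof.
move=> f0; have nz x : f x != 0.
  by apply/eqP => fx; have : zero_set f x by []; rewrite f0.
have mg : measurable_fun setT (fun x => (f x * f x) `^ (-1) * f x).
  apply: measurable_funM => //.
  apply: (measurableT_comp (measurable_powR (-1))).
  exact: measurable_funM.
pose g0 := HB.pack_for {mfun T >-> R} (fun x => (f x * f x) `^ (-1) * f x)
  (isMeasurableFun.Build _ _ _ _ _ mg).
exists g0; apply/val_inj/funext => x /=.
by rewrite fctE powR_inv1 -?expr2 ?sqr_ge0 // -mulrA -expr2 mulVf // expf_neq0.
Qed.

(** [directed_family_fixed] applies to the zero sets of I: an empty one would
make I contain 1, and f^2 + g^2 bounds f and g in the family. *)
Lemma filter_fixed_ideal_fixed (I : set {mfun T >-> R}) :
  all_filters_fixed T -> is_proper_ideal I -> fixed_ideal I.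
Proof.
move=> Kfix /is_proper_idealP[I0 I1 Ilin]; apply: directed_family_fixed => //.
- by exists 0.
- by move=> f _; exact: measurable_zero_set.
- move=> f If; apply/set0P/eqP => /zero_set0_unit[g gf1]; apply: I1.
  by rewrite -gf1 -[g * f]addr0; exact: Ilin.
- move=> f g If Ig; exists (f * f + g * g).
    rewrite -[g * g]addr0; apply: (Ilin) => //; exact: Ilin.
  by rewrite zero_set_sum_squares.
Qed.

(** The zeros of a * u + v contain the common zeros of u and v, and those of 0
and 1 are top and bottom. *)
Lemma filter_ideal_proper (K : set (measurable_lattice T)) :
  proper_lattice_filter K ->
  is_proper_ideal [set f | K (measurable_element (measurable_zero_set f))].
Proof.
move=> Kf; have [_ _ KI Kup] := Kf; apply/is_proper_idealP; split.
- apply: Kup (proper_filter_top Kf) _.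
  by rewrite measurable_lattice_leE => x _; rewrite /zero_set.
- move=> K1; apply: (proper_filter_bot Kf); apply: Kup K1 _.
  by rewrite measurable_lattice_leE => x /= /eqP; rewrite oner_eq0.
- move=> a u v Ku Kv; apply: Kup (KI _ _ Ku Kv) _.
  rewrite measurable_lattice_leE => x [/= ux vx].
  by rewrite /zero_set /= !fctE ux vx mulr0 addr0.
Qed.

Lemma zero_set_indicC (A : set T) (mCA : measurable (~` A)) :
  zero_set (indic_mfun (~` A) mCA : {mfun T >-> R}) = A.
Proof.
apply/seteqP; split=> y; rewrite /zero_set /= mindicE.
  move=> /eqP; rewrite pnatr_eq0 eqb0 => nAy.
  by apply: contrapT => ?; move/negP: nAy; apply; exact/mem_set.
by move=> Ay; rewrite memNset //; apply.
Qed.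

(** A point x fixing a maximal ideal above the ideal of K is a common zero of
the indicators of the complements of the members of K, hence lies in all of
them. *)
Lemma maximal_ideal_fixed_filter_fixed :
  (forall I : set {mfun T >-> R}, is_maximal_ideal I -> fixed_ideal I) ->
  all_filters_fixed T.
Proof.
move=> Mfix K Kf.
have [M maxM KM] := proper_ideal_sub_maximal (filter_ideal_proper Kf).
have [x Mx] := Mfix _ maxM; exists x => A KA.
have mCA := measurableC (measurable_latticeP A).
rewrite -(zero_set_indicC mCA); apply: Mx; apply: KM => /=.
suff -> : measurable_element (measurable_zero_set (indic_mfun _ mCA)) = A by [].
by apply: measurable_lattice_inj; exact: zero_set_indicC.
Qed.

End zero_sets.

Theorem proposition15 (R : realType) (d : measure_display)
    (T : measurableType d) :
  [<-> compact_measurable_space T;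
       forall I : set {mfun T >-> R}, is_proper_ideal I -> fixed_ideal I;
       forall I : set {mfun T >-> R}, is_maximal_ideal I -> fixed_ideal I;
       forall K : set (measurable_lattice T),
         proper_lattice_filter K -> fixed_family K;
       forall K : set (measurable_lattice T),
         lattice_ultrafilter K -> fixed_family K].
Proof.
tfae.
- by move=> cT I; apply: filter_fixed_ideal_fixed; exact: compact_fixed_family.
- by move=> Ifix I [properI _]; exact: Ifix.
- exact: maximal_ideal_fixed_filter_fixed.
- by move=> Kfix K [filterK _]; exact: Kfix.
- move=> Ufix; apply: filter_fixed_compact => K /proper_filter_sub_ultrafilter.
  by move=> [M /Ufix[x Mx] KM]; exists x => A /KM; exact: Mx.
Qed.
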